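(* Let $(W,S)$ be a Coxeter system with $S$ finite, and consider the (right) weak order on $W$. If $v,w\in W$ and the interval $[v,w]$ in the weak order is Boolean, then $\operatorname{supp}(v^{-1}w)\cap \mathrm{Des}(v)=\emptyset$. Furthermore, if $J=\{s_{i_1},\ldots,s_{i_k}\}\subseteq S$ is a set of $k$ pairwise commuting generators and $J\cap\mathrm{Des}(v)=\emptyset$, then $[v,\,v s_{i_1}\cdots s_{i_k}]$ is a Boolean interval of rank $k$.
   Context: For $w\in W$, $\ell(w)$ is the length of $w$ (minimal number of generators in an expression for $w$). The right weak order on $W$ is the partial order with $u\le w$ iff $\ell(w)=\ell(u)+\ell(u^{-1}w)$; its cover relations are $u\lessdot us$ for $s\in S$ with $\ell(us)=\ell(u)+1$. The (right) descent set is $\mathrm{Des}(w)=\{s\in S:\ell(ws)=\ell(w)-1\}$. The support $\operatorname{supp}(w)$ is the set of generators $s\in S$ appearing in some (equivalently every) reduced expression of $w$. An interval is Boolean of rank $k$ if it is isomorphic as a poset to the lattice of subsets of a $k$-element set ordered by inclusion. *)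

(* Defs.v *)
From HB Require Import structures.
From mathcomp Require Import all_boot all_fingroup.
From mathcomp Require Import finmap boolp.

Set Implicit Arguments.
Unset Strict Implicit.
Unset Printing Implicit Defensive.

Local Open Scope group_scope.

Section Coxeter.
Variables (W : groupType) (S : {fset W}).

Definition word_val (u : seq S) : W := \prod_(s <- u) val s.

Section Presentation.
Variable m : S -> S -> nat.

(* The value 0 encodes m(s,t) = infinity. *)
Definition coxeter_matrix : Prop :=
  (forall s t, m s t = m t s) /\ (forall s t, (m s t == 1%N) = (s == t)).

(* The congruence on the free monoid of words generated by (st)^m(s,t) ~ 1.
   Since m(s,s) = 1, it contains ss ~ 1, so the quotient monoid is a group,
   namely < S | (st)^m(s,t) = 1 whenever m(s,t) is finite >.  When m(s,t) = 0
   the relator is the empty word, so the pair imposes no relation. *)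
Inductive word_eqv : seq S -> seq S -> Prop :=
| word_eqv_rel u1 u2 s t :
    word_eqv (u1 ++ flatten (nseq (m s t) [:: s; t]) ++ u2) (u1 ++ u2)
| word_eqv_refl u : word_eqv u u
| word_eqv_sym u u' : word_eqv u u' -> word_eqv u' u
| word_eqv_trans u u' u'' :
    word_eqv u u' -> word_eqv u' u'' -> word_eqv u u''.

Definition presented_by : Prop :=
  (forall w : W, exists u, word_val u = w) /\
  (forall u u', word_val u = word_val u' <-> word_eqv u u').

End Presentation.

Definition coxeter_system : Prop :=
  exists m : S -> S -> nat, coxeter_matrix m /\ presented_by m.

Definition has_word (w : W) (n : nat) : bool :=
  [exists u : n.-tuple S, word_val u == w].

(* The default 0 is never used in a Coxeter system, where S generates W. *)
Definition len (w : W) : nat :=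
  if pselect (exists n, has_word w n) is left ex then ex_minn ex else 0%N.

Definition weak_le (u w : W) : bool := len w == (len u + len (u^-1 * w))%N.

(* Written additively because subtraction on nat is truncated. *)
Definition Des (w : W) : {set S} :=
  [set s : S | (len (w * val s)).+1 == len w].

Definition reduced_word (w : W) (u : seq S) : bool :=
  (word_val u == w) && (size u == len w).

Definition supp (w : W) : {set S} :=
  [set s : S | [exists u : (len w).-tuple S, reduced_word w u && (s \in u)]].

Definition interval (v w : W) := {x : W | weak_le v x && weak_le x w}.

Definition boolean_of_rank (k : nat) (v w : W) : Prop :=
  exists f : interval v w -> {set 'I_k},
    bijective f /\
    forall x y, weak_le (val x) (val y) = (f x \subset f y).

Definition boolean_interval (v w : W) : Prop :=
  exists k, boolean_of_rank k v w.

End Coxeter.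

(* Main.v *)
(* A word determines the sequence of reflections that delete one of its letters;
   the parity with which each reflection occurs is unchanged by the defining
   relations, which yields the exchange condition. Hence all reduced words of an
   element have the same letters.

   In a Boolean interval [v, w] the atoms are v s_1, ..., v s_k. The element lying
   over A is v times the product of the s_i with i in A: when the element over
   C + {a, b} is reached from those over C + {b} and C + {a}, an equality
   s_b s' = s_a s'' of elements of length 2 forces s' = s_a. So w is v times the
   product of the s_i, none of which is a descent of v, and v^-1 w has no other
   letters.

   Conversely, for commuting non-descents of v the products of subsets add their
   cardinality to the length of v, and a reduced word of any v^-1 x with x in the
   interval extends to a reduced word of the full product, so its letters are
   distinct elements of J. *)
Require Import Defs.
From HB Require Import structures.
From mathcomp Require Import all_boot all_fingroup.
From mathcomp Require Import finmap boolp zify.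

Set Implicit Arguments.
Unset Strict Implicit.
Unset Printing Implicit Defensive.

Local Open Scope group_scope.

(** * Words in the generators, their values and their reflections *)

Section Words.
Variables (W : groupType) (S : {fset W}).
Implicit Types (u : seq S) (s t : S) (w x y : W).

Lemma word_val_nil : word_val (Nil S) = 1.
Proof. by rewrite /word_val big_nil. Qed.

Lemma word_val_cons s u : word_val (s :: u) = val s * word_val u.
Proof. by rewrite /word_val big_cons. Qed.

Lemma word_val_cat u u' : word_val (u ++ u') = word_val u * word_val u'.
Proof. by rewrite /word_val big_cat. Qed.

Lemma word_val_seq1 s : word_val [:: s] = val s.
Proof. by rewrite /word_val big_seq1. Qed.

Lemma word_val_rcons u s : word_val (rcons u s) = word_val u * val s.
Proof. by rewrite -cats1 word_val_cat word_val_seq1. Qed.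

Lemma word_val_flatten_nseq n u :
  word_val (flatten (nseq n u)) = word_val u ^+ n.
Proof.
elim: n => [|n IHn] /=; first by rewrite word_val_nil expg0.
by rewrite word_val_cat IHn expgS.
Qed.

Definition commuting u := {in u &, forall s t, commute (val s) (val t)}.

Lemma commuting_sub u u' : {subset u <= u'} -> commuting u' -> commuting u.
Proof. by move=> sub cu' s t /sub us /sub ut; apply: cu'. Qed.

Lemma word_val_commute s u :
  {in u, forall t, commute (val s) (val t)} -> commute (val s) (word_val u).
Proof.
elim: u => [|t u IHu] cu; first by rewrite word_val_nil; apply: commute1.
rewrite word_val_cons; apply: commuteM; first by apply: cu; rewrite mem_head.
by apply: IHu => x ux; apply: cu; rewrite inE ux orbT.
Qed.

Lemma word_val_perm u u' :
  commuting u -> perm_eq u u' -> word_val u = word_val u'.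
Proof.
elim: u u' => [|s u IHu] u' cu; first by rewrite perm_sym => /perm_nilP->.
move=> pu; have us : s \in u' by rewrite -(perm_mem pu) mem_head.
case/splitPr: us pu => u1 u2 pu.
have pu12 : perm_eq u (u1 ++ u2).
  by move: pu; rewrite perm_sym -[s :: u2]cat1s perm_catCA /= perm_cons perm_sym.
rewrite word_val_cons (IHu _ _ pu12); last first.
  by apply: commuting_sub cu => t ut; rewrite inE ut orbT.
rewrite !word_val_cat word_val_cons !mulgA; congr (_ * _).
apply: word_val_commute => t ut; apply: cu; rewrite ?mem_head //.
by rewrite inE (perm_mem pu12) mem_cat ut orbT.
Qed.

Lemma len_le_size u : (len S (word_val u) <= size u)%N.
Proof.
rewrite /len; case: pselect => // ex; case: ex_minnP => n _ min_n.
by apply: min_n; apply/existsP; exists (in_tuple u).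
Qed.

Lemma len1 : len S 1 = 0%N.
Proof. by apply/eqP; rewrite -leqn0 -word_val_nil len_le_size. Qed.

(* The i-th entry of [reflections u] is the reflection r such that deleting the
   i-th letter of [u] multiplies its value by r on the right. *)
Fixpoint reflections u : seq W :=
  if u is s :: u' then (val s ^ word_val u') :: reflections u' else [::].

Lemma reflections_cat u u' :
  reflections (u ++ u') =
    [seq r ^ word_val u' | r <- reflections u] ++ reflections u'.
Proof.
by elim: u => //= s u ->; rewrite word_val_cat conjgM.
Qed.

End Words.

(** * Involutive generators, parity and reflections in a Coxeter system *)

Section CoxeterSystem.
Variables (W : groupType) (S : {fset W}).
Hypothesis coxS : coxeter_system S.
Implicit Types (u : seq S) (s t : S) (v w x y : W).
Local Notation len := (len S).
Local Notation weak_le := (weak_le S).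

Lemma word_exists w : exists u : seq S, word_val u = w.
Proof. by have [m [_ [surj _]]] := coxS; apply: surj. Qed.

Lemma mulg_gen s : val s * val s = 1.
Proof.
have [m [[_ mE] [_ eqvE]]] := coxS; rewrite -[RHS](word_val_nil S).
have -> : val s * val s = word_val ([::] ++ flatten (nseq (m s s) [:: s; s]) ++ [::]).
  move: (mE s s); rewrite eqxx => /eqP->.
  by rewrite /= word_val_cons word_val_seq1.
exact/eqvE/word_eqv_rel.
Qed.

Lemma mulg_genK s : cancel (mulg^~ (val s)) (mulg^~ (val s)).
Proof. by move=> x; rewrite -mulgA mulg_gen mulg1. Qed.

Lemma invg_gen s : (val s)^-1 = val s.
Proof. by rewrite -[LHS]mul1g -(mulg_gen s) mulgK. Qed.

Lemma word_val_rev u : word_val (rev u) = (word_val u)^-1.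
Proof.
elim: u => [|s u IHu]; first by rewrite word_val_nil invg1.
by rewrite rev_cons word_val_rcons IHu word_val_cons invgM invg_gen.
Qed.

(** Every relator $(st)^{m(s,t)}$ has even length, so the defining relations preserve the parity of
    the size. *)
Lemma odd_size_word_val u u' :
  word_val u = word_val u' -> odd (size u) = odd (size u').
Proof.
have [m [_ [_ eqvE]]] := coxS; move/eqvE; elim=> //=; last by move=> ? ? ? _ -> _.
move=> u1 u2 s t; rewrite !size_cat !oddD size_flatten /shape map_nseq.
by rewrite sumn_nseq oddM.
Qed.

(** Since $t$ inverts $p = st$, conjugation by $p$ turns $tp^i$ into $tp^{i+2}$. The leftmost
    letters are conjugated by the longest suffixes and give the largest exponents, hence the
    [rev]. *)
Lemma reflections_alternating_word s t n :
  reflections (flatten (nseq n [:: s; t])) =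
    rev [seq val t * (val s * val t) ^+ j | j <- iota 0 n.*2].
Proof.
set p := val s * val t.
have tJ1 i : (val t * p ^+ i) ^ p = val t * p ^+ i.+2.
  rewrite conjgE -[_ * _ * p]mulgA -expgSr {1}/p invgM !invg_gen.
  by rewrite [p ^+ i.+2]expgS {2}/p !mulgA.
have tJ i j : (val t * p ^+ i) ^ (p ^+ j) = val t * p ^+ (i + j.*2).
  elim: j => [|j IHj] in i *; first by rewrite expg0 conjg1 addn0.
  by rewrite expgS conjgM tJ1 IHj doubleS !addnS.
elim: n => // n IHn; rewrite doubleS -addn2 iotaD map_cat rev_cat add0n -{}IHn.
rewrite /rev /= word_val_cons !word_val_flatten_nseq word_val_cons word_val_seq1 -/p.
rewrite conjgM; congr [:: _, _ & _].
  have -> : val s ^ val t = val t * p ^+ 1 by rewrite expg1 conjgE invg_gen.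
  by rewrite tJ add1n.
by rewrite -{1}[fsval t]mulg1 -(expg0 p) tJ.
Qed.

(* Reflections of the word (st)^m all have the form t(st)^j with 0 <= j < 2m,
   and each value is taken an even number of times because (st)^m = 1. *)
Lemma odd_count_reflections u u' r :
  word_val u = word_val u' ->
  odd (count_mem r (reflections u)) = odd (count_mem r (reflections u')).
Proof.
have [m [_ [_ eqvE]]] := coxS; move/eqvE; elim=> //=; last by move=> ? ? ? _ -> _.
move=> u1 u2 s t; set c := flatten _.
have c1 : word_val c = 1.
  rewrite -(word_val_nil S); apply/eqvE; rewrite -[c]cats0 -[_ ++ _]cat0s.
  exact: word_eqv_rel.
rewrite !reflections_cat !count_cat word_val_cat c1 mul1g !oddD.
suff -> : odd (count_mem r [seq x ^ word_val u2 | x <- reflections c]) = false by [].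
rewrite count_map reflections_alternating_word count_rev count_map.
rewrite -addnn iotaD count_cat oddD add0n.
rewrite word_val_flatten_nseq word_val_cons word_val_seq1 in c1.
apply/eqP; rewrite eqbF_neg negb_add; apply/eqP; congr odd.
have -> : iota (m s t) (m s t) = map (addn (m s t)) (iota 0 (m s t)).
  by rewrite -iotaDl addn0.
rewrite count_map.
by apply: eq_count => j /=; rewrite expgnDr c1 mul1g.
Qed.

Lemma reflection_delete u r :
  r \in reflections u ->
  exists u1 s u2, u = u1 ++ s :: u2 /\ word_val (u1 ++ u2) = word_val u * r.
Proof.
elim: u => //= s u IHu; rewrite inE => /orP[/eqP->|/IHu[u1 [a [u2 [-> eq_val]]]]].
  exists [::], s, u; split=> //=.
  by rewrite word_val_cons conjgE !mulgA -[_ * _ * _^-1]mulgA mulgV mulg1 mulg_gen mul1g.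
by exists (s :: u1), a, u2; split; rewrite //= !word_val_cons eq_val mulgA.
Qed.

(** * The length function *)

Lemma reduced_word_exists w :
  exists2 u : seq S, word_val u = w & size u = len w.
Proof.
have ex : exists n, has_word S w n.
  by have [u uw] := word_exists w; exists (size u); apply/existsP;
    exists (in_tuple u); apply/eqP.
rewrite /Defs.len; case: pselect => // ex'; case: ex_minnP => n /existsP[u /eqP uw] _.
by exists u; rewrite ?size_tuple.
Qed.

Lemma odd_len u : odd (len (word_val u)) = odd (size u).
Proof. by have [u' uE <-] := reduced_word_exists (word_val u); apply: odd_size_word_val. Qed.

Lemma len_gen s : len (val s) = 1%N.
Proof.
by have := len_le_size [:: s]; have := odd_len [:: s]; rewrite word_val_seq1 /=; lia.
Qed.

Lemma len_mul x y : (len (x * y) <= len x + len y)%N.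
Proof.
have [u <- <-] := reduced_word_exists x; have [u' <- <-] := reduced_word_exists y.
by rewrite -word_val_cat -size_cat len_le_size.
Qed.

Lemma len_eq0 x : (len x == 0%N) = (x == 1).
Proof.
apply/eqP/eqP=> [|->]; last exact: len1.
by have [u <- <-] := reduced_word_exists x; move/size0nil->; rewrite word_val_nil.
Qed.

(** The two lengths differ by at most 1, and parity excludes equality. *)
Lemma len_mul_gen w s :
  len (w * val s) = (len w).+1 \/ len w = (len (w * val s)).+1.
Proof.
have [u uE _] := reduced_word_exists w; rewrite -uE -word_val_rcons.
have := odd_len u; have := odd_len (rcons u s); rewrite size_rcons /=.
have := len_mul (word_val u) (val s); have := len_mul (word_val (rcons u s)) (val s).
rewrite word_val_rcons mulg_genK len_gen; lia.
Qed.

Lemma Des_gen w s : s \notin Des S w -> len (w * val s) = (len w).+1.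
Proof. by rewrite inE => /eqP; case: (len_mul_gen w s) => // ->. Qed.

(* Appending s to a reduced word of the shorter element gives a word of the
   element of u in which the reflection s occurs exactly once, so s occurs an odd
   number of times, hence at all, among the reflections of u. *)
Lemma descent_reflection u s :
  (len (word_val u * val s) < len (word_val u))%N -> val s \in reflections u.
Proof.
move=> ltu.
have [u' u'E size_u'] := reduced_word_exists (word_val u * val s).
have eq_u : word_val u = word_val (rcons u' s).
  by rewrite word_val_rcons u'E mulg_genK.
have s_notin : val s \notin reflections u'.
  apply/negP=> /reflection_delete[u1 [a [u2 [def_u' eq_val]]]].
  move: eq_val; rewrite u'E mulg_genK => eq_val.
  have := len_le_size (u1 ++ u2); rewrite eq_val.
  by move: size_u' ltu; rewrite def_u' !size_cat /=; lia.
have := odd_count_reflections (val s) eq_u.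
rewrite -cats1 reflections_cat count_cat count_map /= word_val_nil conjg1 eqxx.
(* Conjugation by $s$ is injective and fixes $s$, so it does not change how often $s$ occurs. *)
rewrite [X in odd (X + _)](eq_count (a2 := pred1 (val s))); last first.
  move=> x /=; rewrite word_val_seq1 -[RHS](inj_eq (@conjg_inj _ (val s))).
  by rewrite [val s ^ val s]conjgE mulKg.
rewrite (count_memPn s_notin) /= => /(congr1 nat_of_bool) cnt.
by rewrite -has_pred1 has_count; case: count cnt.
Qed.

(** * The exchange condition and the letters of reduced words *)

Lemma exchange u s :
  (len (word_val u * val s) < len (word_val u))%N ->
  exists u1 a u2,
    u = u1 ++ a :: u2 /\ word_val (u1 ++ u2) = word_val u * val s.
Proof. by move=> /descent_reflection/reflection_delete. Qed.

(** The reduced word is built by appending one letter at a time; when this lowers the length,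
    exchange deletes an earlier letter instead, so no new letter ever appears. *)
Lemma reduced_subword u :
  exists u', [/\ {subset u' <= u}, word_val u' = word_val u
               & size u' = len (word_val u)].
Proof.
elim/last_ind: u => [|u s [u' [sub eq_val size_u']]].
  by exists [::]; rewrite word_val_nil len1.
rewrite word_val_rcons -eq_val in size_u' *.
have sub_rcons t : t \in u' -> t \in rcons u s.
  by rewrite mem_rcons inE => /sub->; rewrite orbT.
case: (len_mul_gen (word_val u') s) => lenE.
  exists (rcons u' s); split; rewrite ?word_val_rcons ?size_rcons ?lenE ?size_u' //.
  by move=> x; rewrite mem_rcons inE => /predU1P[->|/sub_rcons//]; rewrite mem_rcons mem_head.
have [|u1 [a [u2 [def_u' eq_val']]]] := @exchange u' s; first by rewrite lenE.
exists (u1 ++ u2); split=> //.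
  move=> x xu; apply: sub_rcons; rewrite def_u'; move: xu; rewrite !mem_cat inE.
  by case/orP=> ->; rewrite ?orbT.
by move: lenE; rewrite -size_u' def_u' !size_cat /=; lia.
Qed.

Lemma gen_in_word s u : word_val u = val s -> s \in u.
Proof.
move=> eq_val; have [u' [sub]] := reduced_subword u.
rewrite eq_val len_gen; case: u' sub => [|a [|//]] // sub.
by rewrite word_val_seq1 => /val_inj<- _; apply/sub/mem_head.
Qed.

(** Removing the last letter $s$ of the reduced word corresponds, by exchange, to deleting a letter
    of [u'], so induction handles all letters but $s$. *)
Lemma reduced_letters u u' :
  size u = len (word_val u) -> word_val u = word_val u' -> {subset u <= u'}.
Proof.
elim/last_ind: u u' => // u s IHu u' size_us eq_val.
move: size_us; rewrite size_rcons word_val_rcons => size_us.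
have size_u : size u = len (word_val u).
  have := len_le_size u; have := len_mul (word_val u) (val s); rewrite len_gen; lia.
have [|u1 [a [u2 [def_u' eq_del]]]] := @exchange u' s.
  by rewrite -eq_val word_val_rcons mulg_genK -size_us size_u.
have sub_u : {subset u <= u'}.
  move=> x /(IHu (u1 ++ u2) size_u); rewrite def_u' !mem_cat inE.
  rewrite eq_del -eq_val word_val_rcons mulg_genK => /(_ erefl).
  by case/orP=> ->; rewrite ?orbT.
move=> x; rewrite mem_rcons inE => /predU1P[->|/sub_u//].
(* This word has value $s$, so it contains $s$; an occurrence in [rev u] is already known to lead to
   one in [u']. *)
have : s \in rev u ++ u'.
  by apply: gen_in_word; rewrite word_val_cat word_val_rev -eq_val word_val_rcons mulKg.
by rewrite mem_cat mem_rev => /orP[/sub_u|].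
Qed.

(** * The weak order and lengths of commuting products *)

Lemma weak_le_refl x : weak_le x x.
Proof. by rewrite /Defs.weak_le mulVg len1 addn0. Qed.

Lemma weak_le_trans y x z : weak_le x y -> weak_le y z -> weak_le x z.
Proof.
rewrite /Defs.weak_le => /eqP xy /eqP yz; apply/eqP.
have le_z : (len z <= len x + len (x^-1 * z))%N.
  by have := len_mul x (x^-1 * z); rewrite mulVKg.
have le_xz : (len (x^-1 * z) <= len (x^-1 * y) + len (y^-1 * z))%N.
  by have := len_mul (x^-1 * y) (y^-1 * z); rewrite -mulgA mulVKg.
lia.
Qed.

Lemma weak_le_step x y :
  weak_le x y -> x != y ->
  exists s, weak_le x (x * val s) /\ weak_le (x * val s) y.
Proof.
rewrite /Defs.weak_le => /eqP xy neq_xy.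
(* The generator sought is the first letter of a reduced word of $x^{-1}y$. *)
have [[|s u] uE size_u] := reduced_word_exists (x^-1 * y).
  by move/eqP: neq_xy; case; rewrite -[y](mulVKg x) -uE word_val_nil mulg1.
rewrite word_val_cons in uE; exists s.
have yE : (x * val s)^-1 * y = word_val u by rewrite invgM -mulgA -uE mulKg.
have := len_mul (x * val s) ((x * val s)^-1 * y); have := len_mul x (val s).
have := len_le_size u; rewrite mulVKg mulKg yE len_gen.
by move: size_u; rewrite /=; split; apply/eqP; lia.
Qed.

(** The common value is not 1, so by parity it has length 2 and $tt'$ is reduced; its letter $t$
    must then occur in $ss'$. *)
Lemma diamond s t s' t' :
  s != t -> s != s' -> val s * val s' = val t * val t' -> s' = t.
Proof.
move=> neq_st neq_ss' eq_val.
have eq_word : word_val [:: t; t'] = word_val [:: s; s'].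
  by rewrite !word_val_cons !word_val_nil !mulg1.
have size_t : size [:: t; t'] = len (word_val [:: t; t']).
  have neq1 : word_val [:: t; t'] != 1.
    rewrite eq_word word_val_cons word_val_seq1 -(mulg_gen s) (inj_eq (mulgI _)).
    by rewrite val_eqE eq_sym.
  move: neq1; rewrite -len_eq0.
  by have := len_le_size [:: t; t']; have := odd_len [:: t; t'] => /=; lia.
have := reduced_letters size_t eq_word (mem_head _ _).
by rewrite !inE eq_sym (negPf neq_st) => /eqP.
Qed.

(* If s, which commutes with u, were a descent of v * u, it would occur among the
   reflections of u, making s a letter of u, or among those of a reduced word of v,
   making s a descent of v. *)
Lemma len_mul_commuting v u :
  uniq u -> commuting u -> {in u, forall s, s \notin Des S v} ->
  len (v * word_val u) = (len v + size u)%N.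
Proof.
elim/last_ind: u => [|u s IHu]; first by rewrite word_val_nil mulg1 addn0.
rewrite rcons_uniq => /andP[s_notin uniq_u] comm_us nDes.
have sub : {subset u <= rcons u s} by move=> x xu; rewrite mem_rcons inE xu orbT.
have comm_u := commuting_sub sub comm_us.
have lenu : len (v * word_val u) = (len v + size u)%N.
  by apply: IHu => // x /sub/nDes.
have s_in : s \in rcons u s by rewrite mem_rcons mem_head.
have comm_s : commute (val s) (word_val u).
  by apply: word_val_commute => x /sub xu; apply: comm_us.
rewrite word_val_rcons size_rcons mulgA addnS -lenu.
case: (len_mul_gen (v * word_val u) s) => // lenE.
have [p pE size_p] := reduced_word_exists v.
have : val s \in reflections (p ++ u).
  by apply: descent_reflection; rewrite word_val_cat pE lenE.
rewrite reflections_cat mem_cat => /orP[/mapP[r rp sE]|].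
  have {sE} rE : r = val s.
    by apply: (@conjg_inj _ (word_val u)); rewrite -sE conjgE comm_s mulKg.
  have [p1 [a [p2 [def_p eq_del]]]] := reflection_delete rp.
  have := Des_gen (nDes s s_in); rewrite -size_p -pE -rE -eq_del.
  by have := len_le_size (p1 ++ p2); rewrite def_p !size_cat /=; lia.
move/reflection_delete=> [u1 [a [u2 [def_u eq_del]]]].
have : s \in rev u ++ (u1 ++ u2).
  by apply: gen_in_word; rewrite word_val_cat word_val_rev eq_del mulKg.
rewrite mem_cat mem_rev (negPf s_notin) /= => s_del.
case/negP: s_notin; rewrite def_u; move: s_del; rewrite !mem_cat inE.
by case/orP=> ->; rewrite ?orbT.
Qed.

Lemma len_commuting u : uniq u -> commuting u -> len (word_val u) = size u.
Proof.
move=> uniq_u comm_u; rewrite -[word_val u]mul1g len_mul_commuting ?len1 //.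
by move=> s _; rewrite inE len1.
Qed.

(** A repeated letter could be moved next to its other copy and cancelled, which would shorten the
    word. *)
Lemma uniq_reduced_commuting u :
  commuting u -> size u = len (word_val u) -> uniq u.
Proof.
elim: u => //= s u IHu comm_su; rewrite word_val_cons => size_su.
have comm_u : commuting u.
  by apply: commuting_sub comm_su => t ut; rewrite inE ut orbT.
have size_u : size u = len (word_val u).
  have := len_le_size u; have := len_mul (val s) (word_val u); rewrite -size_su len_gen; lia.
rewrite IHu // andbT; apply/negP=> us.
have := len_le_size (rem s u); rewrite size_rem //.
have <- : val s * word_val u = word_val (rem s u).
  by rewrite (word_val_perm comm_u (perm_to_rem us)) word_val_cons mulgA mulg_gen mul1g.
by rewrite -size_su ltnNge leq_pred.
Qed.

(** * Structure of a Boolean interval *)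

Section BooleanInterval.
Variables (v w : W) (k : nat).
Variables (f : interval S v w -> {set 'I_k}) (g : {set 'I_k} -> interval S v w).
Hypotheses (fK : cancel f g) (gK : cancel g f).
Hypothesis f_mono : forall x y : interval S v w,
  weak_le (val x) (val y) = (f x \subset f y).

Let g_mono A B : weak_le (val (g A)) (val (g B)) = (A \subset B).
Proof. by rewrite f_mono !gK. Qed.

Let g_onto x : weak_le v x -> weak_le x w -> exists A, val (g A) = x.
Proof.
move=> vx xw; have xP : weak_le v x && weak_le x w by rewrite vx.
by exists (f (exist _ x xP)); rewrite fK.
Qed.

Let g_ge A : weak_le v (val (g A)).
Proof. by case/andP: (valP (g A)). Qed.

Let g_le A : weak_le (val (g A)) w.
Proof. by case/andP: (valP (g A)). Qed.

Let le_vw : weak_le v w := weak_le_trans (g_ge set0) (g_le set0).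

Let g_bot : val (g set0) = v.
Proof.
have [A gA] := g_onto (weak_le_refl v) le_vw.
by have := g_ge set0; rewrite -{1}gA g_mono subset0 => /eqP <-.
Qed.

Let g_top : val (g setT) = w.
Proof.
have [A gA] := g_onto le_vw (weak_le_refl w).
have : weak_le (val (g setT)) (val (g A)) by rewrite gA.
by rewrite g_mono subTset => /eqP <-.
Qed.

(** The first weak order step from [g A] towards [g (i |: A)] stays in the interval, hence is some
    [g B] with $B$ between the two sets; $B \neq A$ because a generator is not 1. *)
Lemma boolean_interval_cover (A : {set 'I_k}) i :
  i \notin A -> exists s, val (g (i |: A)) = val (g A) * val s.
Proof.
move=> iA; have le_A : weak_le (val (g A)) (val (g (i |: A))).
  by rewrite g_mono subsetUr.
have [|s [le_s le_sA]] := weak_le_step le_A.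
  apply: contraNneq iA => /val_inj/(can_inj gK) ->; exact: setU11.
have [B gB] := g_onto (weak_le_trans (g_ge A) le_s) (weak_le_trans le_sA (g_le _)).
move: le_s le_sA; rewrite -gB !g_mono => sAB sBA.
exists s; rewrite -gB; congr (val (g _)); apply/eqP; rewrite eqEsubset sBA andbT.
rewrite subUset sAB andbT sub1set; apply: contraT => iB.
have eqAB : A = B.
  apply/eqP; rewrite eqEsubset sAB; apply/subsetP=> j jB.
  by have := subsetP sBA j jB; rewrite !inE => /predU1P[def_j|//]; rewrite -def_j jB in iB.
have := len_gen s; have/eqP := gB; rewrite -eqAB -{1}[val (g A)]mulg1.
by rewrite (inj_eq (mulgI _)) => /eqP <-; rewrite len1.
Qed.

Lemma boolean_interval_atoms :
  exists a : 'I_k -> S,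
    (forall i, a i \notin Des S v) /\ w = v * word_val (map a (rev (enum 'I_k))).
Proof.
have [i|a aP] := @fin_all_exists _ _ (fun i s => val (g [set i]) = v * val s).
  have [|s sE] := @boolean_interval_cover set0 i; first by rewrite inE.
  by exists s; rewrite setU0 g_bot in sE.
have a_inj : injective a.
  move=> i j eq_a; apply: set1_inj; apply: (can_inj gK); apply: val_inj.
  by rewrite /= !aP eq_a.
exists a; split=> [i|].
  have := g_ge [set i]; rewrite aP inE => /eqP; rewrite mulKg len_gen => ->; lia.
(* Induction on a size bound, because the case [i :: j :: l] uses the three shorter lists [l],
   [i :: l] and [j :: l]. Reversal makes the head of the list the rightmost factor. *)
suff gE n (l : seq 'I_k) : (size l <= n)%N -> uniq l ->
    val (g [set i in l]) = v * word_val (map a (rev l)).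
  rewrite -(gE _ _ (leqnn _) (enum_uniq _)).
  apply: etrans (esym g_top) _; congr (val (g _)).
  by apply/setP=> i; rewrite !inE mem_enum.
elim: n => [|n IHn] in l *.
  case: l => //= _ _; rewrite word_val_nil mulg1; apply: etrans g_bot.
  by congr (val (g _)); apply/setP=> i; rewrite !inE.
case: l => [|i [|j l]] size_l uniq_l; first exact: IHn.
  by rewrite word_val_seq1 -aP; congr (val (g _)); apply/setP=> x; rewrite !inE.
move: uniq_l; rewrite [uniq _]/= inE negb_or.
case/and3P=> /andP[neq_ij i_l] j_l uniq_l.
have gl : val (g [set x in l]) = v * word_val (map a (rev l)).
  by apply: IHn => //; apply: leq_trans (leqnSn _) size_l.
have g_cons (x : 'I_k) : x \notin l ->
    val (g [set y in x :: l]) = v * word_val (map a (rev l)) * val (a x).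
  move=> x_l; rewrite IHn /= ?x_l //.
  by rewrite rev_cons map_rcons word_val_rcons mulgA.
have := g_cons i i_l; have := g_cons j j_l => gjl gil.
have [|s] := @boolean_interval_cover [set x in j :: l] i.
  by rewrite !inE negb_or neq_ij.
have [|t] := @boolean_interval_cover [set x in i :: l] j.
  by rewrite !inE negb_or eq_sym neq_ij.
have -> : j |: [set x in i :: l] = [set x in i :: j :: l].
  by apply/setP=> x; rewrite !inE orbCA.
have -> : i |: [set x in j :: l] = [set x in i :: j :: l].
  by apply/setP=> x; rewrite !inE.
rewrite gil gjl => gijl gijl'.
suff def_s : s = a i by rewrite gijl' def_s !rev_cons !map_rcons !word_val_rcons !mulgA.
apply: (@diamond (a j) _ _ t).
- by rewrite (inj_eq a_inj) eq_sym.
(* If $s = a_j$, the two factors cancel and the elements over [i :: j :: l] and [l] coincide,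
   although $i$ is not in [l]. *)
- apply: contraTneq isT => def_s; move: gijl'; rewrite -def_s mulg_genK -gl.
  move/val_inj/(can_inj gK)/setP/(_ i).
  by rewrite !inE eqxx (negPf i_l).
- by apply: (mulgI (v * word_val (map a (rev l)))); rewrite !mulgA -gijl'.
Qed.

End BooleanInterval.

Lemma boolean_interval_supp v w :
  boolean_interval S v w -> supp S (v^-1 * w) :&: Des S v = set0.
Proof.
case=> k [f [[g fK gK] f_mono]].
have [a [nDes ->]] := boolean_interval_atoms fK gK f_mono.
apply/setP=> s; rewrite mulKg [RHS]inE; apply/negP; rewrite inE => /andP[].
rewrite inE => /existsP[u /andP[/andP[/eqP uE /eqP size_u] s_u]].
have /mapP[i _ ->] : s \in map a (rev (enum 'I_k)).
  by apply: (@reduced_letters u); rewrite ?uE.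
by rewrite (negPf (nDes i)).
Qed.

(** * Intervals generated by commuting non-descents *)

Section CommutingInterval.
Variables (v : W) (k : nat) (J : k.-tuple S).
Hypotheses (uniqJ : uniq J) (commJ : commuting J).
Hypothesis nDesJ : {in J, forall s, s \notin Des S v}.

Definition subset_word (A : {set 'I_k}) := [seq tnth J i | i <- enum A].

Let elt A := v * word_val (subset_word A).

Let tnthJ_inj : injective (tnth J).
Proof. exact/tuple_uniqP. Qed.

Let subset_word_sub A : {subset subset_word A <= J}.
Proof. by move=> s /mapP[i _ ->]; apply: mem_tnth. Qed.

Let subset_word_uniq A : uniq (subset_word A).
Proof. by rewrite map_inj_uniq ?enum_uniq. Qed.

Let subset_word_comm A : commuting (subset_word A).
Proof. exact: commuting_sub (@subset_word_sub A) commJ. Qed.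

Let mem_subset_word A i : (tnth J i \in subset_word A) = (i \in A).
Proof. by rewrite mem_map // mem_enum. Qed.

Let len_subset_word A : len (word_val (subset_word A)) = #|A|.
Proof. by rewrite len_commuting // size_map cardE. Qed.

Let len_elt A : len (elt A) = (len v + #|A|)%N.
Proof.
rewrite len_mul_commuting //; first by rewrite size_map cardE.
by move=> s /subset_word_sub/nDesJ.
Qed.

(** If the lengths add up, a word for $A$ extends to a reduced word for $B$, whose letters lie in
    $B$. Conversely, a word for $B$ can be rearranged into one for $A$ followed by one for $B
    \setminus A$. *)
Lemma weak_le_subset_word (A B : {set 'I_k}) :
  weak_le (elt A) (elt B) = (A \subset B).
Proof.
have eltVM : (elt A)^-1 * elt B =
    (word_val (subset_word A))^-1 * word_val (subset_word B).
  by rewrite invgM -mulgA mulKg.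
rewrite /Defs.weak_le !len_elt eltVM; apply/eqP/idP => [lenE|sAB].
  have [r rE size_r] := reduced_word_exists
    ((word_val (subset_word A))^-1 * word_val (subset_word B)).
  have arE : word_val (subset_word A ++ r) = word_val (subset_word B).
    by rewrite word_val_cat rE mulVKg.
  apply/subsetP=> i; rewrite -!mem_subset_word => iA.
  apply: (@reduced_letters (subset_word A ++ r)) => //; last by rewrite mem_cat iA.
  rewrite arE len_subset_word size_cat size_map -cardE size_r.
  by apply/eqP; rewrite -(eqn_add2l (len v)) addnA lenE.
have pB : perm_eq (subset_word B) (subset_word A ++ subset_word (B :\: A)).
  rewrite /subset_word -map_cat perm_map // uniq_perm ?enum_uniq //.
    rewrite cat_uniq !enum_uniq andbT /=; apply/hasPn=> i.
    by rewrite !mem_enum inE => /andP[].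
  move=> i; rewrite mem_cat !mem_enum inE.
  by case iA: (i \in A) => //=; rewrite (subsetP sAB).
rewrite (word_val_perm (@subset_word_comm B) pB) word_val_cat mulKg len_subset_word.
by have := cardsID A B; rewrite (setIidPr sAB); lia.
Qed.

Let eltT : v * word_val J = elt setT.
Proof. by rewrite /elt /subset_word enum_setT -enumT map_tnth_enum. Qed.

Lemma subset_word_onto x :
  weak_le v x -> weak_le x (v * word_val J) -> exists A, x = elt A.
Proof.
rewrite eltT /Defs.weak_le len_elt => /eqP vx /eqP xw.
have [r rE size_r] := reduced_word_exists (v^-1 * x).
have [r' r'E size_r'] := reduced_word_exists (x^-1 * elt setT).
have rr'E : word_val (r ++ r') = word_val (subset_word setT).
  by rewrite word_val_cat rE r'E -mulgA mulVKg mulKg.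
have size_rr' : size (r ++ r') = len (word_val (r ++ r')).
  by rewrite rr'E len_subset_word size_cat; lia.
have rJ : {subset r <= J}.
  move=> s sr; apply: (@subset_word_sub setT); apply: (reduced_letters size_rr' rr'E).
  by rewrite mem_cat sr.
have comm_r := commuting_sub rJ commJ.
(* The reduced word [r] has distinct commuting letters, so its value depends only on its set of
   letters. *)
exists [set i | tnth J i \in r]; rewrite -[LHS](mulVKg v) -rE; congr (_ * _).
apply: word_val_perm => //; apply: uniq_perm => //.
  by apply: uniq_reduced_commuting; rewrite ?rE.
move=> s; apply/idP/idP => [sr|/mapP[i]]; last by rewrite mem_enum inE => ? ->.
by have /tnthP[i def_s] := rJ s sr; rewrite def_s mem_subset_word inE -def_s.
Qed.

Lemma commuting_interval_boolean :
  boolean_of_rank S k v (v * word_val J).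
Proof.
have elt0 : v = elt set0 by rewrite /elt /subset_word enum_set0 word_val_nil mulg1.
have eltP A : weak_le v (elt A) && weak_le (elt A) (v * word_val J).
  by rewrite eltT {1}elt0 !weak_le_subset_word sub0set subsetT.
pose g A : interval S v (v * word_val J) := exist _ (elt A) (eltP A).
(* The subset belonging to $x$ is recovered from the atoms below $x$. *)
pose f (x : interval S v (v * word_val J)) := [set i | weak_le (elt [set i]) (val x)].
have gK : cancel g f.
  by move=> A; apply/setP=> i; rewrite inE weak_le_subset_word sub1set.
have g_onto (x : interval S v (v * word_val J)) : exists A, x = g A.
  have /andP[vx xw] := valP x.
  by have [A xA] := subset_word_onto vx xw; exists A; apply: val_inj.
exists f; split; first by exists g => // x; have [A ->] := g_onto x; rewrite gK.
move=> x y; have [A ->] := g_onto x; have [B ->] := g_onto y.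
by rewrite !gK weak_le_subset_word.
Qed.

End CommutingInterval.

End CoxeterSystem.

Theorem theorem1p1 (W : groupType) (S : {fset W}) (coxS : coxeter_system S) :
  (forall v w : W,
     boolean_interval S v w -> supp S (v^-1 * w)%g :&: Des S v = set0) /\
  (forall (v : W) (k : nat) (J : k.-tuple S),
     uniq J ->
     (forall s t : S, s \in J -> t \in J -> commute (val s) (val t)) ->
     [set s in J] :&: Des S v = set0 ->
     boolean_of_rank S k v (v * \prod_(s <- J) val s)%g).
Proof.
split=> [v w|v k J uniqJ commJ nDesJ]; first exact: boolean_interval_supp.
apply: (commuting_interval_boolean coxS uniqJ) => [s t sJ tJ|s sJ]; first exact: commJ.
by have /setP/(_ s) := nDesJ; rewrite !inE sJ /= => ->.
Qed.
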